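(* Let $\tau$ be an uncountable regular cardinal, $n,m\geq 1$ natural numbers, and $L_1,\ldots,L_m$ compact spaces of weight $\tau$. If $P([0,\tau])^n$ is homeomorphic to $L_1\times\cdots\times L_m$, then $m\leq n$.
   Context: $[0,\tau]$ carries the order topology. $P(X)$ is the space of Radon probability measures on the compact space $X$ with the weak$^*$ topology. *)

(* Defs.v *)
From HB Require Import structures.
From mathcomp Require Import all_boot all_order all_algebra.
From mathcomp Require Import all_classical all_reals all_analysis.
From mathcomp Require Import wochoice.

Set Implicit Arguments.
Unset Strict Implicit.
Unset Printing Implicit Defensive.

Import Order.TTheory GRing.Theory Num.Theory.
Import numFieldNormedType.Exports.

Local Open Scope classical_set_scope.
Local Open Scope card_scope.

Section cardinals.
Context {d : Order.disp_t} (T : orderType d).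
Local Open Scope order_scope.

Definition cofinal (A : set T) := forall x, exists2 a, A a & x <= a.

(* A cardinal is an initial ordinal, and an ordinal is represented by a well  *)
(* order T of that type, i.e., T is the set [0, tau) of the smaller ordinals. *)
(* Since [set: T] has cardinality tau, regularity (cf tau = tau) says that no *)
(* cofinal subset of T has fewer elements than T.                             *)
Record uncountable_regular_cardinal : Prop := UncountableRegularCardinal {
  urc_well_order : well_order (<=%O : rel T) ;
  urc_initial : forall x : T, ~ ([set: T] #<= [set y | y < x]) ;
  urc_regular : forall A : set T, cofinal A -> [set: T] #<= A ;
  urc_uncountable : ~ countable [set: T] }.

End cardinals.

Section closed_segment.
Context {d : Order.disp_t} (T : orderType d).

(* [0, tau] when T is [0, tau): None is the added largest element tau.        *)
Definition with_top : Type := option T.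

Definition with_top_le (x y : with_top) : bool :=
  match x, y with
  | Some a, Some b => (a <= b)%O
  | _, None => true
  | None, Some _ => false
  end.

Let with_top_le_refl : reflexive with_top_le.
Proof. by case=> //= a; exact: lexx. Qed.

Let with_top_le_anti : antisymmetric with_top_le.
Proof. by case=> [a|] [b|] //= /le_anti ->. Qed.

Let with_top_le_trans : transitive with_top_le.
Proof. by case=> [b|] [a|] [c|] //=; exact: le_trans. Qed.

Let with_top_le_total : total with_top_le.
Proof. by case=> [a|] [b|] //=; exact: le_total. Qed.

HB.instance Definition _ := Choice.on with_top.
HB.instance Definition _ := isPointed.Build with_top None.
HB.instance Definition _ := @Order.Le_isPOrder.Build d with_top
  with_top_le with_top_le_refl with_top_le_anti with_top_le_trans.
HB.instance Definition _ :=
  @Order.POrder_isTotal.Build d with_top with_top_le_total.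

Definition closed_segment : Type := order_topology with_top.

HB.instance Definition _ := OrderTopological.copy closed_segment
  (order_topology with_top).
HB.instance Definition _ := Pointed.copy closed_segment with_top.

End closed_segment.

Definition has_weight (X : topologicalType) (T : Type) :=
  (exists2 B : set (set X), basis B & B #= [set: T]) /\
  (forall B : set (set X), basis B -> [set: T] #<= B).

Definition homeomorphic (X Y : topologicalType) :=
  exists f : X -> Y, exists g : Y -> X,
    [/\ cancel f g, cancel g f, continuous f & continuous g].

Section radon_probabilities.
Context (R : realType) (X : ptopologicalType).

Definition borelType := g_sigma_algebraType (@open X).

(* X is meant to be Hausdorff, so that its compact subsets are Borel.         *)
Definition radon (mu : probability borelType R) :=
  forall A : set borelType, measurable A ->
    mu A = ereal_sup [set mu K | K in [set K : set X | compact K /\ K `<=` A]].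

(* A probability is a total function on set borelType with no specified value *)
(* on the sets that are not Borel; we pick the representative that is 0 there *)
(* so that two measures that agree on the Borel sets are one point of P(X).   *)
Definition null_off_borel (mu : probability borelType R) :=
  forall A : set borelType, ~ measurable A -> mu A = 0%E.

Definition radon_prob : Type :=
  set_type [set mu | radon mu /\ null_off_borel mu].

HB.instance Definition _ := Choice.on radon_prob.

Lemma radon_prob_ext (mu nu : radon_prob) :
  (forall A, measurable A -> val mu A = val nu A) -> mu = nu.
Proof.
move=> eq_mn; apply: val_inj; have {eq_mn} : val mu = val nu :> (set _ -> _).
  apply/funext => A; have [/eq_mn //|nA] := pselect (measurable A).
  have [[_ mu0] [_ nu0]] := (set_valP mu, set_valP nu).
  by rewrite [LHS]mu0// [RHS]nu0.
case: (val mu) (val nu) => [m cm] [n cn] /= eq_mn; subst n.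
suff -> : cm = cn by [].
case: cm cn => [[c1 c2] [c3] [c4] [c5] [c6] [c7] [c8]].
case=> [[e1 e2] [e3] [e4] [e5] [e6] [e7] [e8]].
have ? := Prop_irrelevance c1 e1; have ? := Prop_irrelevance c2 e2; subst e1 e2.
by congr Probability.Class; f_equal; apply: Prop_irrelevance.
Qed.

Lemma radon_prob_repr (mu : probability borelType R) :
  hausdorff_space X -> radon mu ->
  exists nu : radon_prob, forall A, measurable A -> val nu A = mu A.
Proof.
move=> hX rmu.
pose m (A : set borelType) :=
  if `[< measurable A >] then mu A else 0%E.
have mE A : measurable A -> m A = mu A by move=> mA; rewrite /m asboolT.
have m0 : m set0 = 0%E by rewrite mE ?measure0.
have mge0 A : (0 <= m A)%E by rewrite /m; case: asboolP => // _;
    exact: measure_ge0.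
have msa : semi_sigma_additive m.
  move=> F mF tF mUF; rewrite mE//.
  rewrite [X in X @ _ --> _](_ : _ = fun n => (\sum_(0 <= i < n) mu (F i))%E).
    exact: measure_semi_sigma_additive.
  by apply/funext => n; apply: eq_bigr => i _; rewrite mE.
have mT : m setT = 1%E by rewrite mE// probability_setT.
pose ms := isMeasure.Build _ borelType R m m0 mge0 msa.
pose mm : measure borelType R := HB.pack m ms.
pose mp := Measure_isProbability.Build _ _ R mm mT.
pose p : probability borelType R := HB.pack m ms mp.
have pP : p \in [set mu | radon mu /\ null_off_borel mu].
  rewrite inE; split => [A mA|A nA]; last by rewrite /= /m asboolF.
  rewrite [LHS]mE// rmu//; congr ereal_sup.
  apply: eq_imagel => K -[cK _]; rewrite [RHS]mE//.
  rewrite -[K]setCK; apply: measurableC; apply: sub_sigma_algebra.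
  by rewrite openC; exact: compact_closed.
by exists (exist _ p pP) => A mA; exact: mE.
Qed.

Definition radon_functional (mu : radon_prob) :
    prod_topology (fun _ : continuousType X R => R : topologicalType) :=
  fun f => (\int[val mu]_(x in [set: borelType]) (f : X -> R) x)%R.

(* P(X): as the codomain of radon_functional has the topology of pointwise    *)
(* convergence on C(X), its initial topology is the weak* one.                *)
Definition radon_prob_space : topologicalType :=
  initial_topology radon_functional.

End radon_probabilities.

(* Main.v *)
From HB Require Import structures.
Require Import Defs.
From mathcomp Require Import all_boot all_order all_algebra.
From mathcomp Require Import all_classical all_reals all_analysis.
From mathcomp Require Import lra.

(** A Radon probability on [0,tau] is determined by its distribution function
    a |-> mu([0,a]) on [0,tau[, because every continuous function is a uniform
    limit of step functions (lemmas step_approximation and cdf_inj).  Every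
    nondecreasing function from [0,tau[ to [0,1] is uniformly approximated by
    distribution functions of averages of Dirac masses (cdf_approximation).
    Hence, if P([0,tau])^n is homeomorphic to a compact product X of the L_i,
    then X is compact, and its points are exactly the n-tuples of nondecreasing
    functions [0,tau[ -> [0,1], with the topology of pointwise convergence
    (homeomorphic_model).  The rest only uses this model of X.

    For a < tau, two points of X agree below a when their n functions have the
    same values on [0,a[.  As tau is regular and uncountable, a closing-off
    argument of countable length finds a limit ordinal a for which this relation
    is a product of equivalence relations on the factors L_i (exists_splits).
    On the classes of such a relation there is a topological preorder: s is
    below t when every neighbourhood of t meets all the classes met by some
    neighbourhood of s (germ_le).  It is computed in two ways.
    - Through the factors, it is the product of the corresponding preorders of
      the L_i (germ_le_prod).
    - Through the functions, s is below t exactly when the values at a of the n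
      functions of s are at most those of t (germ_le_model): near s, the limits
      at a from the left can be raised up to the value at a, and no further.

    Since the weight of L_i is not less than tau, some class of the relation on
    L_i has two elements (nontrivial_fibre), and then some class has elements
    s_i, t_i with t_i not below s_i (nontrivial_germ).  In the class of (s_i)_i,
    the m points obtained by changing one s_k into t_k are not below (s_i)_i,
    but anything below two of them is.  Each of them exceeds (s_i)_i at a in
    some of the n functions; two of them cannot do so in the same function, as
    their pointwise minimum is below both.  Hence m <= n (model_width). *)

Set Implicit Arguments.
Unset Strict Implicit.
Unset Printing Implicit Defensive.

Import Order.TTheory GRing.Theory Num.Theory.
Import numFieldNormedType.Exports.

Local Open Scope classical_set_scope.
Local Open Scope card_scope.
Local Open Scope ring_scope.

(** * Regular cardinals *)

Section regular_cardinal.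
Context {d : Order.disp_t} (T : orderType d).
Context (urcT : uncountable_regular_cardinal T).
Local Open Scope order_scope.

(** These are the types with fewer elements than [T], described by regularity.
    In this form stability under products and finite sequences needs no
    arithmetic of infinite cardinals. *)
Definition small (J : Type) := forall h : J -> T, exists b, forall j, h j <= b.

Lemma urc_min (A : set T) : A !=set0 -> exists2 a, A a & forall b, A b -> a <= b.
Proof.
case=> a0 Aa0; have [|a [[aA lba] _]] := urc_well_order urcT (A := [pred x | `[<A x>]]).
  by exists a0; rewrite inE.
by exists a => [|b Ab]; [move: aA; rewrite inE | apply: lba; rewrite inE].
Qed.

Lemma urc_ind (P : T -> Prop) :
  (forall a, (forall b, b < a -> P b) -> P a) -> forall a, P a.
Proof.
move=> IH a; apply: contrapT => nPa.
have [|c nPc minc] := @urc_min [set x | ~ P x]; first by exists a.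
apply: nPc; apply: IH => b bc; apply: contrapT => /minc.
by rewrite leNgt bc.
Qed.

Lemma small_card (J : Type) : ~ ([set: T] #<= [set: J]) -> small J.
Proof.
move=> nTJ h; have : ~ cofinal (range h).
  by move/(urc_regular urcT) => /card_le_trans/(_ (card_image_le _ _)).
move=> /existsNP[b /forall2NP ub]; exists b => j.
by have [|/negP] := ub (h j); [case; exists j|rewrite -ltNge => /ltW].
Qed.

Lemma small_countable (J : Type) : countable [set: J] -> small J.
Proof.
by move=> cJ; apply: small_card => /card_le_trans/(_ cJ); exact: urc_uncountable.
Qed.

Lemma small_segment (a : T) : small [set x | x < a].
Proof.
apply: small_card; rewrite (card_le_eqr (card_setT _)).
exact: urc_initial.
Qed.

Lemma small_prod (I J : Type) : small I -> small J -> small (I * J).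
Proof.
move=> sI sJ h; have /choice[b hb] := fun i => sJ (fun j => h (i, j)).
by have [c hc] := sI b; exists c => -[i j]; exact: le_trans (hb i j) (hc i).
Qed.

Lemma small_surj (I J : Type) (f : I -> J) :
  (forall j, exists i, f i = j) -> small I -> small J.
Proof.
move=> fsurj sI h; have [b hb] := sI (h \o f).
exists b => j; have [i <-] := fsurj j; exact: hb.
Qed.

(** By induction on the length, and then because there are countably many
    lengths. *)
Lemma small_seq (J : Type) : small J -> small (seq J).
Proof.
move=> sJ; suff small_size n : small {s : seq J | size s = n}.
  move=> h; have /choice[b hb] := fun n => small_size n (fun s => h (sval s)).
  have [c hc] := small_countable (countableP [set: nat]) b.
  exists c => s; apply: le_trans (hc (size s)).
  exact: (hb _ (exist _ s erefl)).
elim: n => [|n IHn] h.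
  exists (h (exist _ [::] erefl)) => -[[|//] e].
  by rewrite (Prop_irrelevance e erefl).
pose consn (p : J * {s : seq J | size s = n}) : {s : seq J | size s = n.+1} :=
  exist _ (p.1 :: sval p.2) (congr1 S (svalP p.2)).
apply: (small_surj (f := consn)); last exact: small_prod.
move=> [[//|x s] e]; have es : size s = n by case: e.
by exists (x, exist _ s es); rewrite /consn /=; congr exist; exact: Prop_irrelevance.
Qed.

Lemma urc_point : inhabited T.
Proof.
apply: contrapT => nT; apply: (urc_uncountable urcT).
suff -> : [set: T] = set0 by exact: countable0.
by rewrite -subset0 => x; case: nT; exists.
Qed.

Lemma urc_unbounded (a : T) : exists b, a < b.
Proof.
apply: contrapT => /forallNP nab; apply: (urc_uncountable urcT).
have : cofinal [set a].
  by move=> x; exists a => //; rewrite leNgt; apply/negP; exact: nab.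
move/(urc_regular urcT) => /card_le_trans; apply.
exact: countable1.
Qed.

(** An injection of [T] into the range of [g] would have, on the indices, an
    inverse whose values are unbounded. *)
Lemma not_le_small (J : Type) (U : Type) (g : J -> U) :
  small J -> ~ ([set: T] #<= range g).
Proof.
move=> sJ /card_leP[i]; pose f (t : T) := val (i (SigSub (mem_set (I : [set: T] t)))).
have f_inj t u : f t = f u -> t = u.
  by move=> /val_inj/(inj (mem_setT _) (mem_setT _)) /(congr1 val).
have /choice[k kP] : forall t, exists j, g j = f t.
  move=> t; have [j _ e] := set_valP (i (SigSub (mem_set (I : [set: T] t)))).
  by exists j; rewrite e.
have [t0] := urc_point.
have [b hb] := sJ (fun j => xget t0 [set t | f t = g j]).
have [c bc] := urc_unbounded b.
have := hb (k c); case: xgetP => [t _ /= |/(_ c)/=]; last by rewrite kP.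
by rewrite kP => /f_inj ->; rewrite leNgt bc.
Qed.

End regular_cardinal.

(** * Compact spaces and continuous functions that separate points *)

(** The limit of an ultrafilter of indices turns several simultaneous choices of
    cluster points into one passage to the limit. *)
Lemma compact_ultra_cvg (Y : topologicalType) (I : Type) (F : set_system I)
    (u : I -> Y) :
  compact [set: Y] -> UltraFilter F -> exists y : Y, u @ F --> y.
Proof.
move=> cY FU; have [y [_ cluy]] := cY (nbhs (fmap u F)) _ filterT.
exists y => A nA; have [//|nFA] := pselect (F (u @^-1` A)).
have FnA : F (u @^-1` ~` A) by have [] := in_ultra_setVsetC (u @^-1` A) FU.
by have [z []] := cluy (~` A) A FnA nA.
Qed.

(** A compact space has the coarsest topology that makes a separating family of
    real functions continuous: otherwise some ultrafilter finer than [F] avoids a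
    neighbourhood of [y], and its limit has the same values as [y]. *)
Lemma compact_cvg_separating (R : realType) (Y : topologicalType) (K : Type)
    (f : K -> Y -> R) (y : Y) (F : set_system Y) : Filter F ->
  compact [set: Y] -> (forall k, continuous (f k)) ->
  (forall y', (forall k, f k y' = f k y) -> y' = y) ->
  (forall k, f k @ F --> f k y) -> F --> y.
Proof.
move=> FF cY cf sepf cvgf W nW; apply: contrapT => nFW.
have PG : ProperFilter (within (~` W) F).
  apply: Build_ProperFilter => G0; apply: nFW.
  by apply: filterS (G0 : F [set x | (~` W) x -> set0 x]) => x; exact: contrapT.
have [G [GU sG]] := ultraFilterLemma PG.
have [p Gp] : exists p : Y, G --> p by exact: (@compact_ultra_cvg _ _ G id cY GU).
suff ep : p = y.
  have GW : G W by apply: Gp; rewrite ep.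
  have GnW : G (~` W) by apply: sG; exact: withinT.
  by have [x []] := filter_ex (filterI GW GnW).
have sFG : F `<=` G by move=> A FA; apply: sG; exact: (cvg_within (FF := FF)) FA.
apply: sepf => k; apply: (@cvg_unique _ (@Rhausdorff R) (f k @ G)).
  by apply: cvg_trans (cf k p); apply: cvg_app.
by apply: cvg_trans (cvgf k) => A /sFG.
Qed.

Lemma cvg_prod_topology (I : eqType) (K : I -> topologicalType)
    (F : set_system (prod_topology K)) (x : prod_topology K) : Filter F ->
  (forall i, (fun z : prod_topology K => z i) @ F --> x i) -> F --> x.
Proof.
move=> FF cvgF; apply/cvg_sup => i A [_ [[B oB <-] Bx] sBA].
by apply: filterS sBA _; apply: cvgF; exact: open_nbhs_nbhs.
Qed.

Lemma compact_prod_topology (I : eqType) (K : I -> topologicalType) :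
  (forall i, compact [set: K i]) -> compact [set: prod_topology K].
Proof.
move/tychonoff; rewrite (_ : [set f | _] = [set: prod_topology K])//.
by apply/seteqP; split.
Qed.

Lemma continuous_dfwith2 (I : eqType) (K : I -> topologicalType) (i : I) :
  continuous (fun p : prod_topology K * K i => dfwith p.1 i p.2 : prod_topology K).
Proof.
move=> p; apply: cvg_prod_topology => j; have [<-|ij] := eqVneq i j.
  apply: (@cvg_trans _ (snd @ p)); last by rewrite dfwithin; exact: cvg_snd.
  by move=> A; apply: (@filterS _ (nbhs p) _ (fun q => A q.2)) => q; rewrite /= dfwithin.
apply: (@cvg_trans _ ((fun q : prod_topology K * K i => q.1 j) @ p)).
  by move=> A; apply: (@filterS _ (nbhs p) _ (fun q => A (q.1 j))) => q; rewrite /= dfwithout.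
rewrite dfwithout//.
apply: (@cvg_comp _ _ _ fst (@proj I K j) _ (nbhs p.1)); first exact: cvg_fst.
exact: proj_continuous.
Qed.

Definition rational_box (R : realType) (Y J : Type) (f : J -> Y -> R)
    (c : seq (J * (rat * rat))) : set Y :=
  [set y | all (fun k => (ratr k.2.1 < f k.1 y < ratr k.2.2)) c].

(** This bounds the weight of a compact space by the number of functions needed
    to separate its points. *)
Lemma rational_box_basis (R : realType) (Y : topologicalType) (J : Type)
    (f : J -> Y -> R) :
  compact [set: Y] -> (forall j, continuous (f j)) ->
  (forall y y', (forall j, f j y = f j y') -> y = y') ->
  basis (range (rational_box f)).
Proof.
move=> cY cf sepf; split=> [_ [c _ <-]|y].
  elim: c => [|k c IHc].
    by rewrite (_ : rational_box f [::] = setT); [exact: openT|exact/seteqP].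
  rewrite (_ : rational_box f (k :: c) =
    f k.1 @^-1` `]ratr k.2.1, ratr k.2.2[ `&` rational_box f c); last first.
    by apply/seteqP; split => z; rewrite /rational_box /= in_itv /= => /andP.
  apply: openI => //; apply: open_comp => // z _; exact: cf.
have nilT : rational_box f [::] = setT by exact/seteqP.
have FF : Filter (filter_from [set U | range (rational_box f) U /\ U y] id).
  apply: filter_from_filter; first by exists setT; split => //; exists [::].
  move=> _ _ [[c _ <-] cy] [[c' _ <-] c'y].
  exists (rational_box f (c ++ c')).
    by split; [exists (c ++ c')|rewrite /rational_box /= all_cat; exact/andP].
  by move=> z /=; rewrite /rational_box /= all_cat => /andP.
apply: compact_cvg_separating cY cf _ _ => [y' yy'|j]; first exact: sepf.
apply/cvgrPdist_lt => e e0.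
have [|q /[!in_itv]/= /andP[q1 q2]] := @rat_in_itvoo R (f j y - e) (f j y).
  by rewrite ltrBlDr ltrDl.
have [|q' /[!in_itv]/= /andP[q'1 q'2]] := @rat_in_itvoo R (f j y) (f j y + e).
  by rewrite ltrDl.
exists (rational_box f [:: (j, (q, q'))]); first split.
- by exists [:: (j, (q, q'))].
- by rewrite /rational_box /= q2 q'1.
move=> z; rewrite /rational_box /= andbT => /andP[z1 z2].
by rewrite ltr_distlC; apply/andP; split; lra.
Qed.

(** * The germ order of a fibre *)

(** Here [E] is an equivalence relation.  If [q] is the quotient map, [s] is below
    [t] when every neighbourhood of [t] has an image under [q] that contains the
    image of a neighbourhood of [s]. *)
Definition germ_le (Y : topologicalType) (E : Y -> Y -> Prop) (s t : Y) :=
  forall V, nbhs t V -> nbhs s [set u | exists2 v, V v & E u v].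

Definition order_limit (d : Order.disp_t) (T : orderType d) (a : T) :=
  (exists b, (b < a)%O) /\ forall b, (b < a)%O -> exists2 c, (b < c)%O & (c < a)%O.

Lemma tail_filter (d : Order.disp_t) (T : orderType d) (D : set T) : D !=set0 ->
  ProperFilter (filter_from D (fun b => [set c | D c /\ (b <= c)%O])).
Proof.
move=> [b0 Db0]; apply: filter_from_proper; last by move=> b Db; exists b.
apply: filter_from_filter; first by exists b0.
move=> b c Db Dc; exists (Order.max b c); first by case: leP.
by move=> e /= [De]; rewrite ge_max => /andP[].
Qed.

Section monotone_models.
Context (R : realType) {d : Order.disp_t} (T : orderType d) (n m : nat).
Context (L : 'I_m -> topologicalType).
Local Notation X := (prod_topology L).

(** The map [ev] identifies the compact product [X] with the set of all n-tuples
    of nondecreasing functions from [T] to the unit interval.  Its topology is then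
    the one of pointwise convergence, see [model_cvg] below. *)
Record monotone_model (ev : T -> 'I_n -> X -> R) : Prop := MonotoneModel {
  model_continuous : forall a j, continuous (ev a j) ;
  model_inj : forall x x', (forall a j, ev a j x = ev a j x') -> x = x' ;
  model_homo : forall j x a b, (a <= b)%O -> ev a j x <= ev b j x ;
  model_ge0 : forall a j x, 0 <= ev a j x ;
  model_le1 : forall a j x, ev a j x <= 1 ;
  model_surj : forall F : T -> 'I_n -> R,
    (forall j a b, (a <= b)%O -> F a j <= F b j) ->
    (forall a j, 0 <= F a j <= 1) -> exists x, forall a j, ev a j x = F a j }.

Context (urcT : uncountable_regular_cardinal T).
Context (cptL : forall i, compact [set: L i]).
Context (ev : T -> 'I_n -> X -> R).
Context (model : monotone_model ev).

Definition agree (a : T) (x x' : X) :=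
  forall b j, (b < a)%O -> ev b j x = ev b j x'.

(** The largest relation on a factor such that a change of one coordinate between
    related elements never leaves a class of [agree a]. *)
Definition agree_at (i : 'I_m) (a : T) (y y' : L i) :=
  forall z : X, agree a (dfwith z i y) (dfwith z i y').

(** The quotient of [X] by [agree a] is then the product of the quotients of the
    factors; the converse implication is [agree_pointwise]. *)
Definition splits (a : T) :=
  forall x x', agree a x x' -> forall i, agree_at a (x i) (x' i).

Let cX : compact [set: X] := compact_prod_topology cptL.

Lemma dfwith_id (x : X) i : dfwith x i (x i) = x.
Proof. by apply: functional_extensionality_dep => j; case: dfwithP. Qed.

(** The coordinates are changed one at a time. *)
Lemma agree_pointwise a (x x' : X) :
  (forall i, agree_at a (x i) (x' i)) -> agree a x x'.
Proof.
move=> xx'; pose w k : X := fun i => if (i < k)%N then x' i else x i.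
have -> : x' = w m.
  by apply: functional_extensionality_dep => i; rewrite /w ltn_ord.
elim: {-2}m (leqnn m) => [_ b j _|k IHk km].
  by congr (ev b j); exact: functional_extensionality_dep.
pose i0 := Ordinal km; move=> b j ba; rewrite (IHk (ltnW km))//.
have -> : w k = dfwith (w k) i0 (x i0).
  by apply: functional_extensionality_dep => i; case: dfwithP => //; rewrite /w /= ltnn.
have -> : w k.+1 = dfwith (w k) i0 (x' i0).
  apply: functional_extensionality_dep => i; case: dfwithP => [|i' ii'].
    by rewrite /w /= leqnn.
  rewrite /w; have -> // : (i' < k.+1)%N = (i' < k)%N.
  by rewrite ltnS leq_eqVlt; case: eqP => // ik; case/eqP: ii'; exact: val_inj.
exact: xx'.
Qed.

(** A continuous function of the i-th coordinate depends, uniformly in the other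
    coordinates [z], on the values of the model below some [b].  If not, there are
    for every [b] points that agree below [b] and differ by a fixed gap; along an
    ultrafilter of tails of [T] they converge to equal points, which contradicts
    the gap.  Countably many gaps then have a common [b]. *)
Lemma coordinate_dependence a i j : exists b, forall x x' z : X, agree b x x' ->
  ev a j (dfwith z i (x i)) = ev a j (dfwith z i (x' i)).
Proof.
pose gap (x x' z : X) := `|ev a j (dfwith z i (x i)) - ev a j (dfwith z i (x' i))|.
suff /choice[b hb] : forall N : nat, exists b, forall x x' z : X,
    agree b x x' -> gap x x' z < N.+1%:R^-1.
  have [c hc] := small_countable urcT (countableP [set: nat]) b.
  exists c => x x' z xx'; apply/eqP; rewrite -subr_eq0 -normr_eq0.
  rewrite eq_le normr_ge0 andbT leNgt; apply/negP => /ltr_add_invr[N].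
  have bN : agree (b N) x x' by move=> e k eb; apply: xx'; exact: lt_le_trans (hc N).
  by rewrite add0r => /(lt_trans (hb N x x' z bN)); rewrite ltxx.
move=> N; apply: contrapT => /forallNP nb.
have /choice[q hq] : forall b, exists q : X * X * X,
    agree b q.1.1 q.1.2 /\ N.+1%:R^-1 <= gap q.1.1 q.1.2 q.2.
  move=> b; have /existsNP[x /existsNP[x' /existsNP[z /not_implyP[xx' /negP]]]] := nb b.
  by rewrite -leNgt => gN; exists (x, x', z).
have [t0] := urc_point urcT.
have [F [FU sF]] := ultraFilterLemma (tail_filter (ex_intro setT t0 I)).
have [x qx] := compact_ultra_cvg (fun b => (q b).1.1) cX FU.
have [x' qx'] := compact_ultra_cvg (fun b => (q b).1.2) cX FU.
have [z qz] := compact_ultra_cvg (fun b => (q b).2) cX FU.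
(* The limits have the same values at every c, eventually passed by b. *)
have exx' : x = x'.
  apply: (model_inj model) => c k.
  apply: (@cvg_unique _ (@Rhausdorff R) ((fun b => ev c k (q b).1.1) @ F)).
    exact: cvg_comp qx (model_continuous model (x := x)).
  apply: (@cvg_trans _ ((fun b => ev c k (q b).1.2) @ F)); last first.
    exact: cvg_comp qx' (model_continuous model (x := x')).
  apply: near_eq_cvg; have [e ce] := urc_unbounded urcT c.
  apply: sF; exists e => // b [_ eb] /=.
  by apply/esym; have [+ _] := hq b; apply; exact: lt_le_trans eb.
have cvgev (u : T -> X) : u @ F --> x ->
    ev a j (dfwith (q b).2 i (u b i)) @[b --> F] --> ev a j (dfwith z i (x i)).
  move=> ux.
  have cvg_ui : (fun b => u b i) @ F --> x i.
    apply: (@cvg_comp _ _ _ u (@proj _ L i) F (nbhs x)) => //.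
    exact: proj_continuous.
  have cvg_dfw : (fun b => dfwith (q b).2 i (u b i) : X) @ F --> (dfwith z i (x i) : X).
    apply: (@cvg_comp _ _ _ (fun b => ((q b).2, u b i))
      (fun p : X * L i => dfwith p.1 i p.2 : X) F (nbhs (z, x i))).
      exact: (cvg_pair (FF := ultra_proper) qz cvg_ui).
    exact: (@continuous_dfwith2 _ L i (z, x i)).
  exact: cvg_comp cvg_dfw (model_continuous model (x := _)).
have := cvgB (cvgev _ qx) (cvgev (fun b => (q b).1.2) _).
rewrite subrr exx' => /(_ ultra_proper qx')/cvgrPdist_lt/(_ N.+1%:R^-1).
rewrite invr_gt0 ltr0n => /(_ isT) FN.
have [b /=] := filter_ex FN; rewrite sub0r normrN.
by rewrite ltNge; have [_ ->] := hq b.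
Qed.
(** The bounds of [coordinate_dependence] for all values below [a] are fewer than
    [T], so that regularity gives a common one. *)
Lemma agree_at_below a : exists2 b, (a < b)%O & forall x x' : X, agree b x x' ->
  forall i, agree_at a (x i) (x' i).
Proof.
have /choice[b hb] : forall p : [set c | (c < a)%O] * ('I_m * 'I_n), exists b,
    forall x x' z : X, agree b x x' ->
    ev (val p.1) p.2.2 (dfwith z p.2.1 (x p.2.1)) =
    ev (val p.1) p.2.2 (dfwith z p.2.1 (x' p.2.1)).
  by move=> p; exact: coordinate_dependence.
have [c hc] := small_prod (small_segment urcT (a := a))
  (small_countable urcT (countableP [set: 'I_m * 'I_n])) b.
have [e] := urc_unbounded urcT (Order.max a c); rewrite gt_max => /andP[ae ce].
exists e => // x x' xx' i z k j ka.
apply: (hb (SigSub (mem_set (ka : [set c | (c < a)%O] k)), (i, j))) => l j' lb.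
by apply: xx'; exact: lt_trans (lt_le_trans lb (hc _)) ce.
Qed.

(** The supremum of a sequence in which each term is the bound given by
    [agree_at_below] for the preceding one. *)
Lemma exists_splits : exists2 a, order_limit a & splits a.
Proof.
have /choice[f /all_and2[ltf splf]] : forall a, exists b, (a < b)%O /\
    forall x x' : X, agree b x x' -> forall i, agree_at a (x i) (x' i).
  by move=> a; have [b] := agree_at_below a; exists b.
have [t0] := urc_point urcT; pose u k := iter k f t0.
have [c uc] := small_countable urcT (countableP [set: nat]) u.
have [|a ua mina] := urc_min urcT (A := [set a | forall k, (u k <= a)%O]).
  by exists c.
have lt_ua k : (u k < a)%O by exact: lt_le_trans (ltf _) (ua k.+1).
have below b : (b < a)%O -> exists k, (b < u k)%O.
  move=> ba; apply: contrapT => /forallNP nbu.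
  have /mina : forall k, (u k <= b)%O by move=> k; rewrite leNgt; exact/negP.
  by rewrite leNgt ba.
exists a.
  split; first by exists (u 0%N).
  by move=> b /below[k bk]; exists (u k).
move=> x x' xx' i z b j /below[k bk]; apply: (splf (u k)) bk.
by move=> e l ek; apply: xx'; exact: lt_trans ek (lt_ua k.+1).
Qed.

(** From left to right, the other coordinates are frozen at those of [s].  From
    right to left, a neighbourhood of [t] contains a box, and related coordinates
    chosen in its sides form a point related to the given one. *)
Lemma germ_le_prod a (s t : X) : splits a ->
  germ_le (agree a) s t <-> forall i, germ_le (@agree_at i a) (s i) (t i).
Proof.
move=> spl; split=> [st i V nV|st V nV].
  have nV' : nbhs t [set v : X | V (v i)] by exact: (@proj_continuous _ L i t).
  have := st _ nV'; rewrite -{1}(dfwith_id s i) => /(@dfwith_continuous _ L s i).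
  apply: (@filterS _ (nbhs (s i))) => y /=.
  by move=> [v Vv /spl/(_ i)]; rewrite dfwithin; exists (v i).
(* The boxes around t generate a filter that converges to t. *)
pose boxes := filter_from [set A : forall i, set (L i) | forall i, nbhs (t i) (A i)]
  (fun A => [set x : X | forall i, A i (x i)]).
have FB : Filter boxes.
  apply: filter_from_filter; first by exists (fun=> setT) => i; exact: filterT.
  move=> A B nA nB; exists (fun i => A i `&` B i) => [i|]; first exact: filterI.
  by move=> x ABx; split=> i; have [] := ABx i.
have boxt : boxes --> t.
  apply: cvg_prod_topology => i A nA.
  exists (dfwith (fun=> setT) i A) => [k|x /(_ i)]; last by rewrite dfwithin.
  by case: dfwithP => // k' _; exact: filterT.
have [A nA sAV] := boxt _ nV.
have nsA i : nbhs s [set x : X | exists2 v, A i v & agree_at a (x i) v].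
  exact: (@proj_continuous _ L i s _ (st i _ (nA i))).
apply: (@filterS _ (nbhs s) _ _ _ _ (@filter_forall _ _ _ (nbhs s) _ nsA)) => x Ax.
have {}Ax i : exists v, A i v /\ agree_at a (x i) v by have [v] := Ax i; exists v.
pose v i := projT1 (cid (Ax i)).
exists v; first by apply: sAV => i; have [] := projT2 (cid (Ax i)).
by apply: agree_pointwise => i; have [] := projT2 (cid (Ax i)).
Qed.

Lemma model_cvg (I : Type) (F : set_system I) (u : I -> X) (x : X) : Filter F ->
  (forall a j, ev a j (u k) @[k --> F] --> ev a j x) -> u @ F --> x.
Proof.
move=> FF cvgu; apply: (@compact_cvg_separating R _ (T * 'I_n)%type
  (fun k => ev k.1 k.2)) cX _ _ _ => [k|x' xx'|k].
- exact: (model_continuous model).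
- by apply: (model_inj model) => a j; exact: (xx' (a, j)).
- exact: cvgu.
Qed.

(** If a value of [s] at [a] is larger than that of [t], the points [u b], which
    take from just after [b] the value of [s] at [a], are arbitrarily close to
    [s], but no point that agrees with them below [a] is close to [t].
    Conversely, a point [u] close to [s] is continued from [a] on by the maximum
    of [t] and of the value of [u] at [a], which gives a point close to [t]. *)
Lemma germ_le_model a (s t : X) : order_limit a -> agree a s t ->
  germ_le (agree a) s t <-> forall j, ev a j s <= ev a j t.
Proof.
move=> [[b0 b0a] lima] st; split=> [leg j|le_st V nV].
  rewrite leNgt; apply/negP => ts.
  pose mid := (ev a j t + ev a j s) / 2.
  have nV : nbhs t [set v | ev a j v < mid].
    have nA : nbhs (ev a j t) [set r | r < mid].
      by apply: open_nbhs_nbhs; split; [exact: open_lt|rewrite /mid/=; lra].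
    exact: (@model_continuous _ model a j t _ nA).
  have /choice[u uE] : forall b, exists x : X, forall c k, ev c k x =
      if (b < c < a)%O then ev a k s else ev c k s.
    move=> b; apply: (model_surj model) => [k c e ce|c k]; last first.
      by case: ifP => _; rewrite (model_ge0 model) (model_le1 model).
    case: ifPn => [/andP[bc ca]|]; case: ifPn => [/andP[be ea]|] //.
    + rewrite negb_and -!leNgt => /orP[eb|ae] ; last exact: (model_homo model).
      by have := lt_le_trans bc (le_trans ce eb); rewrite ltxx.
    + by move=> _; apply: (model_homo model); rewrite ltW// (le_lt_trans ce ea).
    + by move=> _ _; exact: (model_homo model).
  pose G := filter_from [set b | (b < a)%O] (fun b => [set c | (c < a)%O /\ (b <= c)%O]).
  have PG : ProperFilter G by apply: tail_filter; exists b0.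
  have us : u @ G --> s.
    apply: model_cvg => c k; apply: cvg_near_cst.
    have [ca|ac] := ltP c a; last first.
      exists b0 => // b _ /=; rewrite uE; case: ifP => // /andP[_].
      by rewrite ltNge ac.
    by exists c => // b [_ cb] /=; rewrite uE ltNge cb.
  have below : G [set c | (c < a)%O] by exists b0 => // c [].
  have Gu : G [set b | exists2 v, ev a j v < mid & agree a (u b) v].
    exact: us _ (leg _ nV).
  have [b [[v vmid uv] ba]] := filter_ex (filterI Gu below).
  have [c bc ca] := lima b ba.
  have := uv c j ca; rewrite uE bc ca /= => evc.
  have := @model_homo _ model j v c a (ltW ca).
  by move: vmid ts; rewrite /mid -evc; clear => *; lra.
have /choice[v vE] : forall u : X, exists x : X, forall c k, ev c k x =
    if (c < a)%O then ev c k u else Num.max (ev c k t) (ev a k u).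
  move=> u; apply: (model_surj model) => [k c e ce|c k].
    case: (ltP e a) => ea; first by rewrite (le_lt_trans ce ea); exact: (model_homo model).
    case: ltP => ca.
      by rewrite le_max orbC (model_homo model)// ltW// (lt_le_trans ca).
    by rewrite ge_max !le_max lexx orbT (model_homo model).
  case: ifP => _; first by rewrite (model_ge0 model) (model_le1 model).
  by rewrite le_max ge_max (model_ge0 model) !(model_le1 model).
have vt : v @ s --> t.
  apply: (@model_cvg _ (nbhs s) v t (nbhs_filter s)) => c k; have [ca|ac] := ltP c a.
    rewrite -st//; apply: cvg_trans (@model_continuous _ model c k s).
    by apply: near_eq_cvg; apply: nearW => u; rewrite vE ca.
  apply/cvgrPdist_lt => e e0.
  have /cvgrPdist_lt/(_ e e0) := @model_continuous _ model a k s.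
  apply: filterS => u; rewrite vE ltNge ac /= => su.
  have tac := le_trans (le_st k) (@model_homo _ model k t _ _ ac).
  move: su e0 tac; rewrite !ltr_distlC => /andP[].
  by case: (leP (ev c k t) (ev a k u)); clear => *; apply/andP; split; lra.
apply: (@filterS _ (nbhs s)) (vt _ nV) => u Vvu; exists (v u) => // b j ba.
by rewrite vE ba.
Qed.

(** Otherwise the values below [a], fewer than [T], separate the points of a slice
    of [X] that is a copy of [L i], whose weight would then be too small.  One
    slice is enough because [a] splits. *)
Lemma nontrivial_fibre i a : splits a ->
  (forall B : set (set (L i)), basis B -> [set: T] #<= B) ->
  exists y y' : L i, y <> y' /\ agree_at a y y'.
Proof.
move=> spl wL; apply: contrapT => triv.
have [z _] : exists z : X, forall b k, ev b k z = 0.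
  by apply: (model_surj model) => // *; rewrite lexx ler01.
pose f (p : [set c | (c < a)%O] * 'I_n) (y : L i) := ev (val p.1) p.2 (dfwith z i y).
have sJ : small T (seq ([set c | (c < a)%O] * 'I_n * (rat * rat))).
  apply: (small_seq urcT); apply: small_prod; last first.
    by apply: (small_countable urcT); exact: countableP.
  apply: small_prod; first exact: small_segment.
  by apply: (small_countable urcT); exact: countableP.
apply: (not_le_small urcT (g := rational_box f) sJ); apply: wL.
apply: rational_box_basis => // [p y|y y' fyy'].
  apply: (@continuous_comp (L i) X R (dfwith z i) (ev (val p.1) p.2)).
    exact: dfwith_continuous.
  exact: (model_continuous model).
apply: contrapT => yy'; apply: triv; exists y, y'; split => //.
have /spl/(_ i) : agree a (dfwith z i y) (dfwith z i y').
  by move=> b k ba; exact: (fyy' (SigSub (mem_set (ba : [set c | (c < a)%O] b)), k)).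
by rewrite !dfwithin.
Qed.

(** Let [z] consist of functions with constant value 1: it is alone in its class,
    because a nondecreasing function that takes the value 1 keeps it.  Put the two
    elements of a nontrivial class as i-th coordinates of [z]: the two points
    agree below [a] and differ at some [c].  Their common part below [a], continued
    by the minimum or by the maximum of their values at [c], gives two comparable
    points of the same class, which are not equivalent; by the choice of [z] only
    their i-th coordinates differ. *)
Lemma nontrivial_germ i a : order_limit a -> splits a ->
  (forall B : set (set (L i)), basis B -> [set: T] #<= B) ->
  exists s t : L i, agree_at a s t /\ ~ germ_le (@agree_at i a) t s.
Proof.
move=> lima spl /(nontrivial_fibre spl)[y [y' [nyy' yy']]].
have [z z1] : exists z : X, forall b k, ev b k z = 1.
  by apply: (model_surj model) => // *; rewrite ler01 lexx.
pose p := dfwith z i y; pose p' := dfwith z i y'.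
have pp' : agree a p p' by exact: yy'.
have [c [j npp']] : exists c j, ev c j p <> ev c j p'.
  apply: contrapT => epp'; apply: nyy'; rewrite -(dfwithin z y) -(dfwithin z y').
  congr (_ i); apply: (model_inj model) => b k.
  by apply: contrapT => bk; apply: epp'; exists b, k.
have ac : (a <= c)%O by rewrite leNgt; apply/negP => /(pp' c j).
have fill (F : 'I_n -> R) : (forall k, ev c k p <= F k \/ ev c k p' <= F k) ->
    (forall k, F k <= 1) -> exists x : X, forall b k, ev b k x =
      if (b < a)%O then ev b k p else F k.
  move=> pF F1; have pF' b k : (b < a)%O -> ev b k p <= F k.
    move=> ba; have bc := ltW (lt_le_trans ba ac); have [|] := pF k.
      by apply: le_trans; exact: (model_homo model).
    by apply: le_trans; rewrite pp'//; exact: (model_homo model).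
  apply: (model_surj model) => [k b e be|b k].
    case: (ltP e a) => ea; first by rewrite (le_lt_trans be ea); exact: (model_homo model).
    by case: ltP => // ba; exact: pF'.
  case: ifP => _; first by rewrite (model_ge0 model) (model_le1 model).
  rewrite F1 andbT; have [b0 b0a] := lima.1.
  exact: le_trans (model_ge0 model _ _ _) (pF' b0 k b0a).
have [|k|s sE] := fill (fun k => Num.min (ev c k p) (ev c k p')).
- by move=> k; case: (leP (ev c k p) (ev c k p')) => _; [left|right]; exact: lexx.
- by rewrite ge_min (model_le1 model).
have [|k|t tE] := fill (fun k => Num.max (ev c k p) (ev c k p')).
- by move=> k; left; rewrite le_max lexx.
- by rewrite ge_max !(model_le1 model).
have st : agree a s t by move=> b k ba; rewrite sE tE ba.
(* In the class of p, the coordinates other than i are those of z. *)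
have outside (x : X) k : agree a x p -> i != k -> x k = z k.
  move=> xp ik; have := spl _ _ xp k; rewrite /p dfwithout// => xz.
  rewrite -(dfwithin z (x k)); congr (_ k); apply: (model_inj model) => b l.
  have {}xz e : (e < a)%O -> ev e l (dfwith z k (x k)) = 1.
    by move=> ea; rewrite (xz z)// dfwith_id z1.
  rewrite z1; have [ba|ab] := ltP b a; first exact: xz.
  have [b0 b0a] := lima.1; apply/eqP; rewrite eq_le (model_le1 model) /=.
  by rewrite -(xz b0 b0a); apply: (model_homo model); exact: ltW (lt_le_trans b0a ab).
have sp : agree a s p by move=> b k ba; rewrite sE ba.
have tp : agree a t p by move=> b k ba; rewrite tE ba.
exists (s i), (t i); split; first exact: spl st i.
move=> ts; have leg : germ_le (agree a) t s.
  apply/(germ_le_prod _ _ spl) => k; have [<-//|ik] := eqVneq i k.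
  rewrite (outside _ _ sp ik) (outside _ _ tp ik) => V nV.
  by apply: filterS nV => u Vu; exists u.
have := (germ_le_model lima (fun b k ba => esym (st b k ba))).1 leg j.
rewrite sE tE ltxx ge_max !le_min => /andP[/andP[_ le_pp'] /andP[le_p'p _]].
by apply: npp'; apply/eqP; rewrite eq_le le_pp' le_p'p.
Qed.

(** The points [g k] differ from [s] only in the k-th coordinate.  If [g k] and
    [g l], for distinct [k] and [l], exceeded [s] at [a] in the same function, their
    minimum [w] would as well; but [w] is below both, hence below [s] in every coordinate. *)
Lemma model_width :
  (forall i (B : set (set (L i))), basis B -> [set: T] #<= B) -> (m <= n)%N.
Proof.
move=> wL; have [a lima spl] := exists_splits.
have /all_sig[s /(_ _)/cid-/all_sig[t /all_and2[st nts]]] : forall i, {s : L i |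
    exists t : L i, agree_at a s t /\ ~ germ_le (@agree_at i a) t s}.
  by move=> i; exact: cid (nontrivial_germ lima spl (wL i)).
pose g (k : 'I_m) : X := dfwith s k (t k).
have gs k : agree a (g k) s.
  by move=> b j ba; rewrite /g -{2}(dfwith_id s k); apply/esym; exact: st.
have /choice[p hp] : forall k, exists j, ev a j s < ev a j (g k).
  move=> k; apply: contrapT => /forallNP nlt; apply: (nts k).
  have : germ_le (agree a) (g k) s.
    by apply/(germ_le_model lima (gs k)) => j; rewrite leNgt; exact/negP.
  by move=> /(germ_le_prod _ _ spl)/(_ k); rewrite /g dfwithin.
rewrite -[m]card_ord -[n]card_ord; apply: (leq_card p) => k l pkl.
apply/eqP; apply: contrapT => /negP kl.
have [w wE] : exists w : X, forall b j, ev b j w = Num.min (ev b j (g k)) (ev b j (g l)).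
  apply: (model_surj model) => [j b c bc|b j].
    by rewrite le_min !ge_min !(model_homo model _ _ bc)// orbT.
  by rewrite le_min ge_min !(model_ge0 model) (model_le1 model).
have ws : agree a w s by move=> b j ba; rewrite wE !gs// minxx.
have wg h : agree a w (g h) by move=> b j ba; rewrite ws// gs.
have wk : germ_le (agree a) w (g k).
  by apply/(germ_le_model lima (wg k)) => j; rewrite wE ge_min lexx.
have wl : germ_le (agree a) w (g l).
  by apply/(germ_le_model lima (wg l)) => j; rewrite wE ge_min lexx orbT.
have : germ_le (agree a) w s.
  apply/(germ_le_prod _ _ spl) => i; have [ik|ik] := eqVneq i k.
    have := (germ_le_prod _ _ spl).1 wl i; rewrite /g dfwithout//.
    by rewrite ik eq_sym.
  by have := (germ_le_prod _ _ spl).1 wk i; rewrite /g dfwithout// eq_sym.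
move=> /(germ_le_model lima ws)/(_ (p k)); rewrite wE leNgt lt_min hp.
by rewrite pkl hp.
Qed.

End monotone_models.

(** * Probabilities on the segment *)

Section segments.
Context {d : Order.disp_t} (T : orderType d).
Context (urcT : uncountable_regular_cardinal T).
Local Notation K := (closed_segment T).

Definition seg (a : K) : set K := [set k | (k <= a)%O].

Lemma lt_Some (x y : T) : ((Some x : K) < (Some y : K))%O = (x < y)%O.
Proof. by rewrite !lt_neqAle. Qed.

(** [None] is the largest element, so that induction along [T] reaches it last. *)
Lemma segment_ind (P : K -> Prop) :
  (forall a, (forall b : K, (b < a)%O -> P b) -> P a) -> forall a, P a.
Proof.
move=> IH; have PS x : P (Some x).
  elim/(urc_ind urcT): x => x IHx; apply: IH => -[y|]; last by [].
  by rewrite lt_Some => /IHx.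
by case=> [x|]; [exact: PS|apply: IH => -[y|//]].
Qed.

(** [a] is the largest element or has a successor. *)
Lemma seg_open a : open (seg a).
Proof.
case: a => [x|]; last first.
  by rewrite (_ : seg None = setT); [exact: openT|apply/seteqP; split=> // -[]].
have [y /= xy miny] := urc_min urcT (urc_unbounded urcT x).
rewrite (_ : seg _ = `]-oo, (Some y : K)[%classic); first exact: lray_open.
apply/seteqP; split=> -[z|//]; rewrite /seg /= in_itv /=.
  by move=> zx; rewrite lt_Some; exact: le_lt_trans xy.
rewrite lt_Some => zy; rewrite leNgt lt_Some; apply/negP => xz.
have : (y <= z)%O by apply: miny.
by rewrite leNgt => /negP; apply.
Qed.

Lemma seg_closed a : closed (seg a).
Proof.
rewrite (_ : seg a = `]-oo, a]%classic); first exact: lray_closed.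
by apply/seteqP; split => z; rewrite /seg /= in_itv.
Qed.

(** To the left of [a] a neighbourhood contains a half-open interval; only this
    side matters, as initial segments are built from the left. *)
Lemma nbhs_segment (a : K) (U : set K) : nbhs a U ->
  seg a `<=` U \/ exists2 b, (b < a)%O & forall x, (b < x)%O -> (x <= a)%O -> U x.
Proof.
rewrite itv_nbhsE => -[[l r] [oi ai] sU].
have inr x : (x <= a)%O -> (BRight x <= r)%O.
  move=> xa; move: ai; rewrite itv_boundlr => /andP[_]; apply: le_trans.
  by rewrite leBSide.
case: l oi ai sU => [[] b|[]] oi ai sU.
- by move: oi; case: r {sU inr ai} => [[]|[]].
- right; exists b => [|x bx xa]; first by move: ai; rewrite itv_boundlr => /andP[].
  by apply: sU; rewrite /= itv_boundlr inr// andbT.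
- by left => x xa; apply: sU; rewrite /= itv_boundlr inr.
- by [].
Qed.

Section step_functions.
Context (R : realType).

Definition step (s : seq (R * K)) (x : K) : R := \sum_(p <- s) p.1 * \1_(seg p.2) x.

(** By induction, [f] is approximated on the initial segment of each [a]: it is
    nearly constant on an interval that ends at [a], and the step function found
    for the left end [b] of this interval is cut at [b]. *)
Lemma step_approximation (f : K -> R) (e : R) : continuous f -> 0 < e ->
  exists s, forall x, `|f x - step s x| <= e.
Proof.
move=> cf e0; suff [s hs] : exists s, forall x, (x <= None :> K)%O -> `|f x - step s x| <= e.
  by exists s => x; apply: hs; case: x.
elim/segment_ind: (None : K) => a IHa.
have nU : nbhs a [set x | `|f x - f a| <= e].
  have /cvgrPdist_le/(_ e e0) := cf a.
  by apply: filterS => x; rewrite distrC.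
have [sU|[b ba sU]] := nbhs_segment nU.
  exists [:: (f a, a)] => x xa; rewrite /step big_seq1 /= indicE mem_set// mulr1.
  exact: sU.
have [s hs] := IHa b ba.
exists ((f a, a) :: (- f a, b) :: [seq (p.1, Order.min p.2 b) | p <- s]) => x xa.
rewrite /step !big_cons big_map /= !indicE mem_set// mulr1.
have [xb|bx] := leP x b.
  rewrite mem_set// mulr1 addrA subrr add0r.
  rewrite (eq_bigr (fun p => p.1 * \1_(seg p.2) x)) => [|p _]; first exact: hs.
  rewrite !indicE; congr (_ * _%:R); congr nat_of_bool; apply/idP/idP;
  by rewrite !inE /seg /= le_min xb andbT.
rewrite memNset; last by rewrite /seg /= leNgt bx.
rewrite mulr0 big1 ?addr0 => [|p _]; first exact: sU.
by rewrite indicE memNset ?mulr0// /seg /= le_min [X in _ && X]leNgt bx andbF.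
Qed.

Lemma step_bounded s x : `|step s x| <= \sum_(p <- s) `|p.1|.
Proof.
apply: le_trans (ler_norm_sum _ _ _) _; apply: ler_sum => p _.
by rewrite normrM ler_piMr// indicE; case: (_ \in _); rewrite ?normr1 ?normr0.
Qed.

End step_functions.
End segments.

(** * Distribution functions *)

Section distribution_functions.
Context (R : realType) {d : Order.disp_t} (T : orderType d).
Context (urcT : uncountable_regular_cardinal T).
Local Notation K := (closed_segment T).
Local Notation borelK := (borelType K).

Lemma open_borel (A : set K) : open A -> measurable (A : set borelK).
Proof. exact: sub_sigma_algebra. Qed.

Lemma seg_measurable (a : K) : measurable (seg a : set borelK).
Proof. by apply: open_borel; exact: seg_open. Qed.

Lemma continuous_borel (f : K -> R) : continuous f ->
  measurable_fun [set: borelK] (f : borelK -> R).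
Proof.
move=> /continuousP cf; apply: (measurability _ (measurable_realfun.RGenOpens.measurableE R)).
move=> _ [_ [a [b ->] <-]]; rewrite setTI; apply: open_borel.
exact/cf/interval_open.
Qed.

Section integral.
Context (mu : probability borelK R).

Lemma integrable_indic_seg (a : K) :
  mu.-integrable [set: borelK] (EFin \o (\1_(seg a) : borelK -> R)).
Proof. by apply: integrable_indic; exact: seg_measurable. Qed.

Lemma Rintegral_indic_seg (a : K) :
  (\int[mu]_(x in [set: borelK]) (\1_(seg a) x : R))%R = fine (mu (seg a)).
Proof.
rewrite /Rintegral integral_indic ?setIT//; exact: seg_measurable.
Qed.

Lemma integrable_step (s : seq (R * K)) :
  mu.-integrable [set: borelK] (EFin \o (step s : borelK -> R)).
Proof.
rewrite (_ : _ \o _ =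
    fun x : borelK => (\sum_(p <- s) (p.1%:E * (\1_(seg p.2) x)%:E))%E).
  apply: integrable_sum => // p _.
  by apply: integrableZl => //; exact: integrable_indic_seg.
by apply/funext => x; rewrite /step /= sumEFin.
Qed.

Lemma Rintegral_step (s : seq (R * K)) :
  (\int[mu]_(x in [set: borelK]) (step s x : R))%R = \sum_(p <- s) p.1 * fine (mu (seg p.2)).
Proof.
elim: s => [|p s IHs].
  rewrite big_nil (@eq_Rintegral _ _ _ mu _ (cst 0)) ?Rintegral_cst ?mul0r//.
  by move=> x _; rewrite /step big_nil.
rewrite big_cons -IHs -Rintegral_indic_seg -RintegralZl//; last exact: integrable_indic_seg.
rewrite -RintegralD//; last exact: integrable_step.
  by apply: eq_Rintegral => x _; rewrite /step big_cons.
have := integrableZl measurableT p.1 (integrable_indic_seg p.2); exact.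
Qed.

Lemma integrable_continuous (f : K -> R) : continuous f ->
  mu.-integrable [set: borelK] (EFin \o (f : borelK -> R)).
Proof.
move=> cf; apply: measurable_bounded_integrable => //.
- by rewrite (le_lt_trans (probability_le1 _ _))// ltry.
- exact: continuous_borel.
have [s hs] := step_approximation urcT cf ltr01.
exists (\sum_(p <- s) `|p.1| + 1); split; first by rewrite num_real.
move=> M lM x _ /=; apply/ltW/(le_lt_trans _ lM).
rewrite -[f x](subrK (step s x)) (le_trans (ler_normD _ _))// addrC lerD//.
exact: step_bounded.
Qed.

Lemma Rintegral_step_approximation (f : K -> R) (s : seq (R * K)) (e : R) :
  continuous f -> (forall x, `|f x - step s x| <= e) ->
  `|(\int[mu]_(x in [set: borelK]) f x)%R - \sum_(p <- s) p.1 * fine (mu (seg p.2))| <= e.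
Proof.
move=> cf fs; have intf := integrable_continuous cf; have ints := integrable_step s.
have intB : mu.-integrable [set: borelK]
    (EFin \o (fun x : borelK => f x - step s x)).
  have := integrableB measurableT intf ints; exact.
rewrite -Rintegral_step -RintegralB//.
apply: le_trans (le_normr_Rintegral _ _) _ => //.
rewrite [leRHS](_ : _ = (\int[mu]_(x in [set: borelK]) (cst e x))%R); last first.
  rewrite Rintegral_cst// -[LHS]mulr1; congr (_ * _).
  exact: (esym (congr1 fine (probability_setT mu))).
apply: le_Rintegral => //.
- exact: integrable_norm.
- by apply: finite_measure_integrable_cst.
Qed.

End integral.

Definition cdf (mu : radon_prob R K) (a : T) : R := fine (val mu (seg (Some a))).

(** The integral of a step function is a combination of values of the distribution
    function. *)
Lemma cdf_inj (mu nu : radon_prob R K) :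
  cdf mu =1 cdf nu -> radon_functional mu = radon_functional nu.
Proof.
move=> mn; apply: functional_extensionality_dep => f; rewrite /radon_functional.
have mnK (a : K) : fine (val mu (seg a)) = fine (val nu (seg a)).
  case: a => [a|]; first exact: mn.
  have -> : seg None = [set: K] by apply/seteqP; split => // -[].
  by rewrite !probability_setT.
have cf : continuous (f : K -> R) by exact: cts_fun.
apply/eqP; rewrite -subr_eq0 -normr_eq0 eq_le normr_ge0 andbT.
apply/ler_addgt0Pr => e e0; rewrite add0r.
have [|s hs] := step_approximation urcT cf (e := e / 2); first by rewrite divr_gt0.
have := Rintegral_step_approximation (val mu) cf hs.
have := Rintegral_step_approximation (val nu) cf hs.
rewrite (eq_bigr (fun p => p.1 * fine (val mu (seg p.2)))); last by move=> p _; rewrite mnK.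
rewrite !ler_distl => /andP[? ?] /andP[? ?].
by apply/andP; split; lra.
Qed.

Lemma cdf_homo (mu : radon_prob R K) a b : (a <= b)%O -> cdf mu a <= cdf mu b.
Proof.
move=> ab; apply: fine_le; rewrite ?fin_num_measure//; try exact: seg_measurable.
apply: le_measure; rewrite ?inE; try exact: seg_measurable.
by move=> x /= /le_trans; apply.
Qed.

Lemma cdf_ge0 (mu : radon_prob R K) a : 0 <= cdf mu a.
Proof. exact: fine_ge0. Qed.

Lemma cdf_le1 (mu : radon_prob R K) a : cdf mu a <= 1.
Proof.
rewrite -lee_fin fineK ?fin_num_measure ?probability_le1//; exact: seg_measurable.
Qed.

(** Initial segments are clopen, so that their indicators are continuous. *)
Lemma cdf_continuous a :
  continuous (fun mu : radon_prob_space R K => cdf (mu : radon_prob R K) a).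
Proof.
have ci : continuous (\1_(seg (Some a)) : K -> R).
  move=> x A /nbhs_singleton; have [xa|xa] := pselect (seg (Some a) x).
    have nx : nbhs x (seg (Some a)) by apply: open_nbhs_nbhs; split => //; exact: seg_open.
    rewrite indicE mem_set// => A1; apply: (@filterS _ (nbhs x) _ _ _ _ nx) => y ya.
    by rewrite /= indicE mem_set.
  have nx : nbhs x (~` seg (Some a)).
    by apply: open_nbhs_nbhs; split => //; rewrite openC; exact: seg_closed.
  rewrite indicE memNset// => A0; apply: (@filterS _ (nbhs x) _ _ _ _ nx) => y ya.
  by rewrite /= indicE memNset.
pose i : continuousType K R := mkcts ci.
rewrite (_ : (fun _ => _) = (fun mu : radon_prob_space R K => radon_functional mu i)).
  move=> mu; apply: (@continuous_comp (radon_prob_space R K)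
    (prod_topology (fun _ : continuousType K R => R : topologicalType)) R
    (@radon_functional R K) (@proj _ (fun _ => R) i) mu).
    exact: (@initial_continuous _ _ (@radon_functional R K) mu).
  exact: (@proj_continuous _ (fun _ : continuousType K R => R : topologicalType)
    i (radon_functional mu)).
by apply/funext => nu; rewrite /radon_functional /= Rintegral_indic_seg.
Qed.

Lemma measure_probability (m : measure borelK R) : m setT = 1%E ->
  exists mu : probability borelK R, forall A, mu A = m A.
Proof.
case: m => m cm m1; pose mm : measure borelK R := Measure.Pack cm.
pose mp := Measure_isProbability.Build _ borelK R mm m1.
by pose mu : probability borelK R := HB.pack m cm mp; exists mu.
Qed.

(** An average of finitely many Dirac masses is Radon: a Borel set [A] has the same
    mass as the finite set of the atoms in [A]. *)
Lemma empirical_radon_prob (p : nat -> K) (N : nat) : exists mu : radon_prob R K,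
  forall a, cdf mu a = N.+1%:R^-1 * \sum_(k < N.+1) (p k <= Some a)%O%:R.
Proof.
have N0 : 0 <= N.+1%:R^-1 :> R by rewrite invr_ge0 ler0n.
pose emp := mscale (NngNum N0) (msum (fun k => \d_(p k : borelK)) N.+1)
  : {measure set borelK -> \bar R}.
have empE (A : set borelK) : emp A = (N.+1%:R^-1 * \sum_(k < N.+1) (p k \in A)%:R)%:E.
  by rewrite /emp/= /mscale/= /msum EFinM -sumEFin; congr (_ * _)%E;
     apply: eq_bigr => k _; rewrite diracE.
have emp1 : emp setT = 1%E.
  rewrite empE (eq_bigr (fun=> 1)) => [|k _]; last by rewrite in_setT.
  by rewrite sumr_const card_ord mulVf.
have [mu muE] := measure_probability emp1.
have rmu : radon mu.
  move=> A mA; apply/eqP; rewrite eq_le; apply/andP; split; last first.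
    apply: ge_ereal_sup => _ [C [cC CA] <-]; apply: le_measure => //; rewrite inE//.
    rewrite -[C]setCK; apply: measurableC; apply: open_borel; rewrite openC.
    exact: compact_closed order_hausdorff cC.
  have finp : finite_set ((p @` `I_N.+1) `&` A).
    by apply: finite_setIl; apply: finite_image; exact: finite_II.
  apply: ereal_sup_ubound; exists ((p @` `I_N.+1) `&` A).
    by split => //; exact: finite_compact.
  rewrite !muE !empE; congr (_ * _)%:E; apply: eq_bigr => k _; congr (nat_of_bool _)%:R.
  apply/idP/idP; rewrite !inE; first by case.
  by move=> pA; split => //; exists (k : nat) => //=.
have hK : hausdorff_space K by exact: order_hausdorff.
have [nu nuE] := radon_prob_repr hK rmu.
exists nu => a; rewrite /cdf nuE; last exact: seg_measurable.
rewrite muE empE /=; congr (_ * _); apply: eq_bigr => k _.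
by congr (nat_of_bool _)%:R; rewrite mem_setE.
Qed.

Lemma count_le_floor (y : R) (M : nat) : 0 <= y <= M%:R ->
  y - 1 <= \sum_(k < M) (k.+1%:R <= y)%R%:R <= y.
Proof.
elim: M => [|M IHM] /andP[y0 yM]; rewrite ?big_ord0 ?big_ord_recr /=.
  by rewrite y0 andbT; lra.
have [My|yM'] := ltP M%:R y; last first.
  have -> : (M.+1%:R <= y) = false.
    by apply/negP => /le_trans/(_ yM'); rewrite ler_nat ltnn.
  by rewrite addr0; apply: IHM; rewrite y0.
rewrite (eq_bigr (fun=> 1)) => [|k _]; last first.
  by rewrite (le_trans _ (ltW My))// ler_nat ltn_ord.
rewrite sumr_const card_ord; case: (leP M.+1%:R y) => My1 /=.
  by rewrite natr1 My1 andbT; lra.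
by rewrite addr0 lerBlDr natr1 !ltW.
Qed.

(** The atoms are the quantiles: the k-th one is the first point where [F] reaches
    (k+1)/(N+1), and the top element if there is none. *)
Lemma cdf_approximation (F : T -> R) (N : nat) :
  {homo F : a b / (a <= b)%O >-> a <= b} -> (forall a, 0 <= F a <= 1) ->
  exists mu : radon_prob R K, forall a, `|cdf mu a - F a| <= N.+1%:R^-1.
Proof.
move=> Fhomo F01.
have /choice[p hp] : forall k : nat, exists q : K, forall a,
    (q <= Some a)%O = (k.+1%:R / N.+1%:R <= F a).
  move=> k; have [ne|ne] := pselect ([set a | k.+1%:R / N.+1%:R <= F a] !=set0).
    have [b /= kb minb] := urc_min urcT ne; exists (Some b) => a.
    apply/idP/idP => [ba|/minb//]; exact: le_trans kb (Fhomo _ _ ba).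
  exists None => a; apply/idP/idP => [//|ka]; case: ne; exists a; exact: ka.
have [mu muE] := empirical_radon_prob p N; exists mu => a; rewrite muE.
have N0 : 0 < N.+1%:R :> R by rewrite ltr0n.
have /andP[F0 F1] := F01 a.
have yN : 0 <= F a * N.+1%:R <= N.+1%:R 
  by apply/andP; split; [exact: mulr_ge0 F0 (ltW N0)|exact: ler_piMl (ltW N0) F1].
have /andP := count_le_floor yN.
rewrite (eq_bigr (fun k : 'I_N.+1 => (p k <= Some a)%O%:R)); last first.
  by move=> k _; rewrite hp ler_pdivrMr.
set c := \sum_(_ < _) _ => -[c1 c2].
have -> : N.+1%:R^-1 * c - F a = (c - F a * N.+1%:R) / N.+1%:R.
  by rewrite mulrBl mulfK ?gt_eqF// mulrC.
rewrite normrM normfV (gtr0_norm N0) ler_piMl ?invr_ge0 ?(ltW N0)//.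
by rewrite ler_distl c1 (le_trans c2)// lerDl ler01.
Qed.

End distribution_functions.

(** * Powers of the space of probabilities that are products *)

Section homeomorphic_product.
Context (R : realType) {d : Order.disp_t} (T : orderType d) (n m : nat).
Context (L : 'I_m -> topologicalType).
Context (urcT : uncountable_regular_cardinal T).
Context (cptL : forall i, compact [set: L i]).
Context (hausL : forall i, hausdorff_space (L i)).
Local Notation P := (radon_prob_space R (closed_segment T)).
Local Notation Pn := (prod_topology (fun _ : 'I_n => P)).
Local Notation X := (prod_topology L).

(** Points of [X] with the same distribution functions are inseparable, hence equal
    as [X] is Hausdorff.  A tuple of nondecreasing functions is reached as a limit
    of the approximations, by compactness of [X]. *)
Lemma homeomorphic_model (f : Pn -> X) (g : X -> Pn) :
  cancel f g -> cancel g f -> continuous f -> continuous g ->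
  monotone_model (fun a j x => cdf (g x j : radon_prob R (closed_segment T)) a).
Proof.
move=> fK gK cf cg.
have cptX : compact [set: X] := compact_prod_topology cptL.
have cev a j : continuous (fun x : X => cdf (g x j : radon_prob R (closed_segment T)) a).
  move=> x; apply: (@continuous_comp X P R (fun x => g x j) (fun mu => cdf mu a)).
    apply: (@continuous_comp X Pn P g (@proj _ (fun _ : 'I_n => P) j)); first exact: cg.
    exact: (@proj_continuous _ (fun _ : 'I_n => P) j (g x)).
  exact: cdf_continuous.
split=> [//|x x' xx'|j x a b|a j x|a j x|F Fhomo F01].
- have inseparable V : nbhs x V -> V x'.
    rewrite -{1}(gK x) => /cf; suff gx : globally [set g x'] --> g x.
      by move=> /gx/(_ (g x') erefl) /=; rewrite gK.
    apply: (@cvg_prod_topology _ (fun _ : 'I_n => P)) => j A [B [[C oC <-] Bx] sBA].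
    move=> _ ->; apply: sBA; rewrite /preimage /=.
    rewrite -(@cdf_inj R d T urcT (g x j) (g x' j))// => a; exact: xx'.
  apply: functional_extensionality_dep => i; apply: hausL => A B nA nB.
  exists (x' i); split; last exact: nbhs_singleton.
  exact: inseparable _ (@proj_continuous _ L i x _ nA).
- exact: cdf_homo.
- exact: cdf_ge0.
- exact: cdf_le1.
have /choice[u hu] : forall N : nat, exists x : X, forall j a,
    `|cdf (g x j : radon_prob R (closed_segment T)) a - F a j| <= N.+1%:R^-1.
  move=> N; have /choice[mu hmu] : forall j, exists mu : radon_prob R (closed_segment T),
      forall a, `|cdf mu a - F a j| <= N.+1%:R^-1.
    by move=> j; apply: cdf_approximation => // a b; exact: Fhomo.
  by exists (f mu) => j a; rewrite fK.
have [G [GU sG]] := ultraFilterLemma (eventually_filter : ProperFilter \oo).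
have [x ux] := compact_ultra_cvg u cptX GU.
exists x => a j; apply: (@cvg_unique _ (@Rhausdorff R)
    ((fun k => cdf (g (u k) j : radon_prob R (closed_segment T)) a) @ G)).
  exact: cvg_comp ux (cev a j x).
apply/cvgrPdist_lt => e e0; apply: sG.
have := near_infty_natSinv_lt (PosNum e0); apply: filterS => k /= ke.
by rewrite distrC (le_lt_trans (hu k j a)).
Qed.

End homeomorphic_product.

Theorem theorem1p8 (R : realType) (d : Order.disp_t) (T : orderType d)
    (n m : nat) (L : 'I_m -> topologicalType) :
  uncountable_regular_cardinal T ->
  (1 <= n)%N -> (1 <= m)%N ->
  (forall i, hausdorff_space (L i)) ->
  (forall i, compact [set: L i]%classic) ->
  (forall i, has_weight (L i) T) ->
  homeomorphic (prod_topology (fun _ : 'I_n => radon_prob_space R (closed_segment T)))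
               (prod_topology L) ->
  (m <= n)%N.
Proof.
move=> urcT _ _ hausL cptL wL [f [g [fK gK cf cg]]].
apply: (model_width urcT cptL (homeomorphic_model urcT cptL hausL fK gK cf cg)).
by move=> i; exact: (wL i).2.
Qed.
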